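(* Let $X$ and $Y$ be Banach spaces and $H$ a Hilbert space with inner product $\langle\cdot,\cdot\rangle$, with continuous injections $X\hookrightarrow Y\hookrightarrow H$ having dense images. Let $T\colon X\to Y$ be a (bounded) Fredholm operator which is symmetric, i.e. $\langle Tx_1,x_2\rangle=\langle x_1,Tx_2\rangle$ for all $x_1,x_2\in X$. In addition, assume that the following ellipticity hypothesis is satisfied: for all $x\in Y^*$, $T^*(x)\in Y$ implies $x\in X$, i.e. $(T^* )^{-1}(Y)\subset X$. Then the Fredholm index of $T$ is zero.
   Context: Taking adjoints of the continuous inclusions $X\hookrightarrow Y\hookrightarrow H$ and identifying $H$ with $H^*$ through the inner product gives the chain of continuous inclusions $X\hookrightarrow Y\hookrightarrow H=H^*\hookrightarrow Y^*\hookrightarrow X^*$. With these identifications, by symmetry of $T$, the adjoint operator $T^*\colon Y^*\to X^*$ is an extension of $T$. The conditions $T^*(x)\in Y$ and $x\in X$ are understood through these inclusions ($Y\subset X^*$ and $X\subset Y^*$). *)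

(* Defs.v *)
From HB Require Import structures.
From mathcomp Require Import all_boot all_order all_algebra.
From mathcomp Require Import all_classical all_reals all_analysis.
From mathcomp Require Import complex.

Set Implicit Arguments.
Unset Strict Implicit.
Unset Printing Implicit Defensive.

Import Order.TTheory GRing.Theory Num.Theory.
Import numFieldNormedType.Exports.

Local Open Scope classical_set_scope.
Local Open Scope ring_scope.

(* [RorC K theta]: the scalar field [K] is the real or the complex numbers,
   and [theta] is the conjugation of [K], which is the identity for reals.
   A form of type [{dot H for theta}] is linear in its first argument. *)
Inductive RorC : forall K : numFieldType, (K -> K) -> Prop :=
| RorC_real (R : realType) : @RorC R idfun
| RorC_complex (R : realType) : @RorC R[i] (@conjc R).

Section Dimension.
Variables (K : fieldType) (V : lmodType K).
Implicit Types A B : set V.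

(* For linear subspaces [A `<=` B] of [V]: the vectors [v 0, ..., v (n - 1)]
   lie in [B] and their classes modulo [A] form a basis of [B / A]. *)
Definition quotient_basis B A n (v : 'I_n -> V) : Prop :=
  [/\ forall k, B (v k),
      forall c : 'I_n -> K, A (\sum_(k < n) c k *: v k) -> forall k, c k = 0
    & forall u, B u -> exists c : 'I_n -> K, A (u - \sum_(k < n) c k *: v k)].

Definition quotient_dim_eq B A n : Prop :=
  exists v : 'I_n -> V, quotient_basis B A v.

(* The junk value 0 is taken when [B / A] is infinite-dimensional. *)
Definition quotient_dim B A : nat := xget 0%N (quotient_dim_eq B A).

End Dimension.

Section Operators.
Variables (K : numFieldType) (X Y : normedModType K).
Implicit Types T : X -> Y.

Definition ker T : set X := T @^-1` [set 0].

(* Between Banach spaces the closedness of the range follows from the finite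
   dimension of the cokernel; it is listed as in the textbook definition. *)
Definition fredholm T : Prop :=
  [/\ continuous T,
      exists n, quotient_dim_eq (ker T) [set 0] n,
      closed (range T)
    & exists n, quotient_dim_eq [set: Y] (range T) n].

Definition fredholm_index T : int :=
  (quotient_dim (ker T) [set 0])%:Z - (quotient_dim [set: Y] (range T))%:Z.

End Operators.

Section Duality.
Variable K : numFieldType.

Definition dual (V : normedModType K) : set (V -> K^o) :=
  [set phi | linear phi /\ continuous phi].

Definition adjoint (V W : normedModType K) (T : V -> W) (phi : W -> K^o) :
  V -> K^o := phi \o T.

(* The identification of [H] with its dual; it is conjugate-linear in [u]. *)
Definition riesz (H : normedModType K) (ip : H -> H -> K) (u : H) : H -> K^o :=
  fun h => ip h u.

End Duality.

(* Main.v *)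
Require Import Defs.
From HB Require Import structures.
From mathcomp Require Import all_boot all_order all_algebra.
From mathcomp Require Import all_classical all_reals all_analysis.
From mathcomp Require Import complex ring.

Set Implicit Arguments.
Unset Strict Implicit.
Unset Printing Implicit Defensive.

Import Order.TTheory GRing.Theory Num.Theory.
Import numFieldNormedType.Exports.

Local Open Scope classical_set_scope.
Local Open Scope ring_scope.

(** The index vanishes because [ker T] and [ker T^*] are the same subspace of
    [Y^*].  By symmetry and density of [i], an element of [X], seen in [Y^*]
    through the inner product, annihilates [range T] exactly when [T] kills it
    ([embed_dual_kerP]); by ellipticity, applied with [T^* phi = 0], which lies
    in [Y], every continuous functional annihilating [range T] comes from such
    an element.  On the other hand [ker T^*] is the dual of [Y / range T], so its
    dimension is that of the cokernel ([ker_dim]).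

    The analytic content of the last sentence is that the coordinates of
    [Y / range T], as linear functionals on [Y], are continuous
    ([continuous_coords]).  A functional with closed kernel is continuous
    ([closed_ker_continuous]), and the kernel of one coordinate is [range T]
    enlarged by the other basis vectors, so what is needed is that adjoining one
    vector to a closed subspace gives a closed subspace ([closed_adjoin]).  The
    proof of that uses the completeness of [Y] and the fact that the inner
    product of [H] provides continuous functionals separating the points of [Y].

    Since the Riesz identification is conjugate-linear, so is the isomorphism of
    [ker T] with [ker T^*]; it is expressed by transporting the basis of
    [ker T^*] given by the coordinates to a basis of [ker T]. *)

(** * Linear subspaces and dimension of quotients *)

(** The counterpart of [submod_closed] for sets with values in [Prop]. *)
Definition linear_subspace (K : fieldType) (V : lmodType K) (F : set V) :=
  F 0 /\ forall (a : K) (u w : V), F u -> F w -> F (a *: u + w).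

Section LinearSubspace.
Variables (K : fieldType) (V : lmodType K) (F : set V).
Hypothesis subF : linear_subspace F.

Lemma subspaceD u w : F u -> F w -> F (u + w).
Proof. by move=> Fu Fw; rewrite -[u]scale1r; apply: subF.2. Qed.

Lemma subspaceZ a u : F u -> F (a *: u).
Proof. by move=> Fu; rewrite -[_ *: _]addr0; apply: subF.2 => //; case: subF. Qed.

Lemma subspaceB u w : F u -> F w -> F (u - w).
Proof.
by move=> Fu Fw; apply: subspaceD => //; rewrite -scaleN1r; apply: subspaceZ.
Qed.

Lemma subspace_sum (I : finType) (E : I -> V) :
  (forall k, F (E k)) -> F (\sum_k E k).
Proof.
by move=> FE; elim/big_ind: _ => // [|u w]; [case: subF | apply: subspaceD].
Qed.

End LinearSubspace.

Lemma subspace0 (K : fieldType) (V : lmodType K) :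
  linear_subspace [set 0 : V].
Proof. by split=> // a u w /= -> ->; rewrite scaler0 addr0. Qed.

Lemma subspace_range (K : fieldType) (V W : lmodType K) (f : {linear V -> W}) :
  linear_subspace (range f).
Proof.
split=> [|a _ _ [x _ <-] [y _ <-]]; first by exists 0; rewrite ?linear0.
by exists (a *: x + y); rewrite ?linearP.
Qed.

Section DimensionUnique.
Variables (K : fieldType) (V : lmodType K) (B A : set V).
Hypothesis subA : linear_subspace A.

(** If [m] exceeded [n], the [m] by [n] matrix of coordinates of the second
    family in the first one would have a nonzero row vector in its kernel, which
    is a nontrivial relation modulo [A]. *)
Lemma quotient_basis_leq n m (v : 'I_n -> V) (w : 'I_m -> V) :
  quotient_basis B A v -> quotient_basis B A w -> (m <= n)%N.
Proof.
move=> [Bv fv sv] [Bw fw sw].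
have /choice[c cP] : forall j, exists d : 'I_n -> K,
  A (w j - \sum_(k < n) d k *: v k) by move=> j; apply: sv.
rewrite leqNgt; apply/negP => ltnm.
pose M : 'M[K]_(m, n) := \matrix_(j, k) c j k.
have /rowV0Pn[b /sub_kermxP bM] : kermx M != 0.
  rewrite -mxrank_eq0 mxrank_ker subn_eq0 -ltnNge.
  exact: leq_ltn_trans (rank_leq_col M) ltnm.
case/negP; apply/eqP/rowP => j; rewrite mxE.
apply: (fw (fun j => b 0 j)) => {j}.
have -> : \sum_j b 0 j *: w j =
    \sum_j b 0 j *: (w j - \sum_(k < n) c j k *: v k).
  under [RHS]eq_bigr do rewrite scalerBr.
  rewrite sumrB [X in _ - X](_ : _ = 0) ?subr0 //.
  under eq_bigr do rewrite scaler_sumr.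
  rewrite exchange_big big1 //= => k _.
  under eq_bigr do rewrite scalerA.
  rewrite -scaler_suml; have /rowP/(_ k) := bM; rewrite !mxE.
  by under eq_bigr do rewrite mxE; move=> ->; rewrite scale0r.
by apply: subspace_sum => // j; apply: subspaceZ.
Qed.

Lemma quotient_dimE n : quotient_dim_eq B A n -> quotient_dim B A = n.
Proof.
move=> [v bv]; rewrite /quotient_dim.
case: xgetP => [m _ [w bw]|/(_ n)]; last by case; exists v.
by apply: anti_leq; rewrite (quotient_basis_leq bv bw) (quotient_basis_leq bw bv).
Qed.

End DimensionUnique.

(** * Coordinates modulo a closed subspace of finite codimension *)

Section Coordinates.
Variables (K : fieldType) (V : lmodType K) (F : set V) (m : nat).
Variable v : 'I_m -> V.
Hypothesis subF : linear_subspace F.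
Hypothesis vbasis : quotient_basis [set: V] F v.

Lemma quotient_coords : exists c : 'I_m -> {linear V -> K^o},
  [/\ forall u, F (u - \sum_k c k u *: v k),
      forall k u, F u -> c k u = 0
    & forall k l, c k (v l) = (k == l)%:R].
Proof.
have [_ free span] := vbasis.
have /choice[c cP] : forall u, exists d : 'I_m -> K,
  F (u - \sum_k d k *: v k) by move=> u; apply: span.
have cE u (d : 'I_m -> K) : F (u - \sum_k d k *: v k) -> d =1 c u.
  move=> Fd k; apply/eqP; rewrite -subr_eq0; apply/eqP.
  apply: (free (fun k => d k - c u k)) => {k}.
  rewrite (eq_bigr _ (fun k _ => scalerBl _ _ _)) sumrB.
  have -> : \sum_i d i *: v i - \sum_i c u i *: v i
    = (u - \sum_k c u k *: v k) - (u - \sum_k d k *: v k).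
    by rewrite opprB [RHS]addrC addrA subrK.
  exact: subspaceB.
have lin k : linear (fun u => c u k : K^o).
  move=> a u w /=; apply/esym.
  apply: (cE _ (fun k => a * c u k + c w k)).
  rewrite (eq_bigr (fun k => a *: (c u k *: v k) + c w k *: v k)); last first.
    by move=> l _; rewrite scalerDl scalerA.
  rewrite big_split /= -scaler_sumr opprD addrACA -scalerBr.
  exact: subF.2.
pose f k : {linear V -> K^o} := HB.pack (fun u => c u k : K^o)
  (GRing.isLinear.Build _ _ _ _ _ (lin k)).
exists f.
split=> [u|k u Fu|k l] /=.
- exact: cP.
- rewrite -(cE u (fun=> 0)) // big1 ?subr0 // => l _; exact: scale0r.
- rewrite -(cE (v l) (fun k => (k == l)%:R)) //.
  rewrite (bigD1 l) //= eqxx scale1r big1 ?addr0 ?subrr; first by case: subF.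
  by move=> j /negPf ->; rewrite scale0r.
Qed.

End Coordinates.

Section Continuity.
Variables (K : numFieldType).

(** With [d] the radius of a ball around [v] that misses [F]: the vector
    [v - w / g w] lies in [F], so its distance [`|w / g w|] to [v] is at least
    [d]. *)
Lemma coord_bounded (Y : normedModType K) (F : set Y) (g : Y -> K) (v : Y) :
  closed F -> linear_subspace F -> ~ F v ->
  exists2 d : K, 0 < d &
    forall w, F (w - g w *: v) -> d * `|g w| <= `|w|.
Proof.
move=> clF subF Fv.
have /nbhs_ballP[d /= d0 dF] : nbhs v (~` F).
  by apply: open_nbhs_nbhs; split => //; apply: closed_openC.
exists d => // w Fw; have [->|gw0] := eqVneq (g w) 0.
  by rewrite normr0 mulr0.
have gw0' : 0 < `|g w| by rewrite normr_gt0.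
rewrite -ler_pdivlMr // real_leNgt ?realE ?(ltW d0) ?divr_ge0 //.
apply/negP => ltd; apply: (dF (v - (g w)^-1 *: w)).
  by rewrite -ball_normE /= opprB addrC subrK normrZ normfV mulrC.
rewrite (_ : _ - _ = - (g w)^-1 *: (w - g w *: v)); first exact: subspaceZ.
by rewrite scalerBr scalerA !scaleNr mulNr mulVf // scaleNr scale1r opprK addrC.
Qed.

(** Every [w] is congruent modulo the kernel to a multiple of a fixed vector, so
    [coord_bounded] bounds [g] on the whole space. *)
Lemma closed_ker_continuous (Y : normedModType K) (g : {linear Y -> K^o}) :
  closed (g @^-1` [set 0]) -> continuous g.
Proof.
move=> clg; have [g0|/existsNP[v /eqP gv]] := pselect (forall u, g u = 0).
  by rewrite (_ : (g : Y -> K^o) = cst 0); [exact: cst_continuous | exact/funext].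
have subg : linear_subspace (g @^-1` [set 0]).
  by split=> [|a u w /= gu gw]; rewrite /= ?linear0 // linearP gu gw scaler0 addr0.
pose v1 := (g v)^-1 *: v.
have gv1 : g v1 = 1 by rewrite linearZ; apply: mulVf.
have [|d d0 dg] := coord_bounded g clg subg (v := v1).
  by rewrite /= gv1; apply/eqP/oner_neq0.
apply: bounded_linear_continuous; apply/linear_boundedP.
exists d^-1; split=> [|r dr x]; first by rewrite ger0_real // invr_ge0 ltW.
apply: (@le_trans _ _ (d^-1 * `|x|)); last by rewrite ler_wpM2r // ltW.
rewrite ler_pdivlMl // dg //= linearB linearZ /= gv1.
by rewrite /GRing.scale /= mulr1 subrr.
Qed.

(** For [u] in the closure, the filter of neighbourhoods of [u] inside the
    enlarged space is sent by [w |-> g w *: v] to a Cauchy filter, since [g] is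
    bounded there; its limit is a multiple of [v] because [psi] recovers the
    coefficient.  Completeness of [Y] and [psi] together replace completeness
    of the scalars. *)
Lemma closed_adjoin (Y : completeNormedModType K) (F : set Y)
    (g psi : {linear Y -> K^o}) (v : Y) :
  closed F -> linear_subspace F -> ~ F v -> continuous psi -> psi v = 1 ->
  F `<=` g @^-1` [set 0] -> g v = 1 ->
  closed [set u | F (u - g u *: v)].
Proof.
move=> clF subF Fv cpsi psiv Fg gv.
have [d d0 dg] := coord_bounded g clF subF Fv.
set G := [set u | _] => u clu.
pose W := within G (nbhs u).
have PW : ProperFilter W by apply: within_nbhs_proper.
have v0 : 0 < `|v|.
  by rewrite normr_gt0; apply/eqP => v0; apply: Fv; rewrite v0; case: subF.
have GB w w' : G w -> G w' -> G (w - w').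
  move=> Gw Gw'; rewrite /G /= linearB scalerBl opprD addrACA -opprD.
  exact: subspaceB.
have GW : \forall w \near W, G w by apply: withinT.
have idW : id @ W --> u by apply: cvg_within.
pose p w := g w *: v : Y.
have /cvg_ex[z pz] : cvg (p @ W).
  apply: cauchy_cvg; apply: cauchy_exP => e e0.
  (* [g] varies by at most [2 * r / d] on the ball of radius [r], so [p] varies
     by at most [2 * r / d * `|v| = e]. *)
  pose r := d * e / `|v| / 2.
  have r0 : 0 < r by rewrite !divr_gt0 // mulr_gt0.
  have nearu : \forall w \near W, ball u r w.
    exact: idW (nbhsx_ballx u r r0).
  have [w0 [Gw0 uw0]] := filter_ex (filterI GW nearu).
  exists (p w0); apply: filterS (filterI GW nearu) => w [Gw uw] /=.
  rewrite -ball_normE /= /p -scalerBl normrZ -linearB.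
  rewrite -ltr_pdivlMr // -(ltr_pM2l d0).
  apply: le_lt_trans (dg _ (GB _ _ Gw0 Gw)) _.
  rewrite mulrA -[ltRHS](@divfK _ 2) // mulr_natr mulr2n.
  rewrite (_ : w0 - w = (w0 - u) + (u - w)); last by rewrite addrA subrK.
  apply: le_lt_trans (ler_normD _ _) _; rewrite ltrD //.
  - by move: uw0; rewrite -ball_normE /= distrC.
  - by move: uw; rewrite -ball_normE.
(* The coefficient of [p w] is read off continuously, hence survives the limit. *)
have psip w : psi (p w) = g w by rewrite linearZ psiv; apply: mulr1.
have zE : z = psi z *: v.
  have pz' : p @ W --> (psi z *: v : Y).
    rewrite (_ : p = (fun w => psi (p w) *: v)); last by apply/funext=> w; rewrite psip.
    by apply: cvgZr_tmp; apply: (continuous_cvg _ (cpsi z)).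
  exact: (cvg_unique _ pz pz').
have Fuz : F (u - z).
  apply: (@closed_cvg _ _ W _ (fun w => w - p w) F clF GW).
  by apply: cvgB.
have gu : g u = psi z.
  apply/eqP; rewrite -subr_eq0; apply/eqP; rewrite -(Fg _ Fuz) linearB.
  by rewrite [in RHS]zE linearZ gv; congr (_ - _); apply/esym/mulr1.
by rewrite /G /= gu -zE.
Qed.

Section ContinuousCoords.
Variables (Y : completeNormedModType K) (F : set Y) (m : nat) (v : 'I_m -> Y).
Variable c : 'I_m -> {linear Y -> K^o}.
Hypothesis separated : forall y : Y, y != 0 ->
  exists2 psi : {linear Y -> K^o}, continuous psi & psi y != 0.
Hypothesis clF : closed F.
Hypothesis cP : forall u, F (u - \sum_k c k u *: v k).
Hypothesis cF : forall k u, F u -> c k u = 0.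
Hypothesis cv : forall k l, c k (v l) = (k == l)%:R.

(** The space where only the coordinates of index in [s] may be nonzero is [F]
    with the corresponding vectors adjoined one after the other. *)
Lemma closed_coords (s : seq 'I_m) :
  closed [set u | forall l, l \notin s -> c l u = 0].
Proof.
elim: s => [|k s IHs].
  rewrite (_ : mkset _ = F) //; apply/seteqP; split=> u /= => [cu|Fu l _].
    have := cP u; rewrite big1 ?subr0 // => l _.
    by rewrite cu ?scale0r.
  exact: cF.
have [ks|ks] := boolP (k \in s).
  rewrite (_ : mkset _ = [set u | forall l, l \notin s -> c l u = 0]) //.
  apply/seteqP; split=> u /= cu l ls; apply: cu; move: ls; rewrite inE ?negb_or.
    by move=> ls; rewrite ls andbT; apply: contraNneq ls => ->.
  by case/andP.
set G := mkset _ in IHs.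
have vk0 : v k != 0.
  by apply/eqP => vk0; have /eqP := cv k k; rewrite eqxx vk0 linear0 eq_sym oner_eq0.
have [psi cpsi psiv] := separated vk0.
pose a := (psi (v k))^-1.
have cvk : c k (v k) = 1 by rewrite cv eqxx.
have clG : closed [set u | G (u - c k u *: v k)].
  have cpsi1 : continuous (a \*: psi : Y -> K^o) by move=> y; apply: cvgZl_tmp; apply: cpsi.
  apply: (closed_adjoin (psi := (a \*: psi)%R)) => //.
  - split=> [l _|b u w Gu Gw l ls]; first by rewrite linear0.
    by rewrite linearP Gu // Gw // scaler0 addr0.
  - by move/(_ k ks)/eqP; rewrite cvk oner_eq0.
  - exact: mulVf.
  - by move=> u; apply.
rewrite (_ : mkset _ = [set u | G (u - c k u *: v k)]) //.
apply/seteqP; split=> u /= cu l; last first.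
  rewrite inE negb_or => /andP[lk ls]; have := cu l ls.
  by rewrite linearB linearZ /= cv (negPf lk) scaler0 subr0.
rewrite linearB linearZ /= cv; have [->|lk] := eqVneq l k.
  by move=> _; rewrite /GRing.scale /= mulr1 subrr.
by move=> ls; rewrite scaler0 subr0 cu // inE negb_or lk.
Qed.

Lemma continuous_coords k : continuous (c k).
Proof.
apply: closed_ker_continuous.
rewrite (_ : _ @^-1` _ = [set u | forall l, l \notin enum (predC1 k) -> c l u = 0]).
  exact: closed_coords.
apply/seteqP; split=> u /= => [cu l|]; last by apply; rewrite mem_enum inE eqxx.
by rewrite mem_enum !inE negbK => /eqP ->.
Qed.

End ContinuousCoords.
End Continuity.

(** * The inner product *)

Lemma RorC_conjugation (K : numFieldType) (theta : K -> K) :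
  RorC theta -> involutive theta /\ forall a, `|a| ^+ 2 = a * theta a.
Proof.
case=> R; split=> //.
- by move=> a; rewrite real_normK ?num_real // expr2.
- exact: conjcK.
- exact: sqr_normc.
Qed.

Section InnerProduct.
Variables (K : numFieldType) (theta : K -> K) (hK : RorC theta).
Variables (H : normedModType K) (ip : {dot H for theta}).
Hypothesis hH : forall u : H, `|u| ^+ 2 = ip u u.

Lemma ipC u w : ip u w = theta (ip w u).
Proof. by have := @hermitian_subproof _ _ _ _ ip u w; rewrite mul1r. Qed.

Lemma ipBl u w h : ip (u - w) h = ip u h - ip w h.
Proof. exact: linearBl. Qed.

Lemma ipZl a u h : ip (a *: u) h = a * ip u h.
Proof. exact: linearZl_LR. Qed.

Lemma ipBr u w h : ip h (u - w) = ip h u - ip h w.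
Proof. exact: linearBr. Qed.

Lemma ipZr a u h : ip h (a *: u) = theta a * ip h u.
Proof. exact: linearZr_LR. Qed.

Lemma ip_definite u : ip u u = 0 -> u = 0.
Proof. by rewrite -hH => /eqP; rewrite sqrf_eq0 normr_eq0 => /eqP. Qed.

(** Expand the squared norm of [ip u u *: h - ip h u *: u]. *)
Lemma cauchy_schwarz h u : `|ip h u| <= `|u| * `|h|.
Proof.
have [thetaK normE] := RorC_conjugation hK.
have [->|u0] := eqVneq u 0; first by rewrite linear0r !normr0 mul0r.
have N0 : 0 < ip u u by rewrite -hH exprn_gt0 // normr_gt0.
rewrite -ler_sqr ?nnegrE ?mulr_ge0 // exprMn !hH -subr_ge0 -(pmulr_rge0 _ N0).
set N := ip u u; set c := ip h u.
rewrite (_ : _ * _ = `|N *: h - c *: u| ^+ 2) ?exprn_ge0 //.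
rewrite hH ipBr !ipBl !ipZl !ipZr.
rewrite -/c -/N (ipC u h) -/c -(ipC u u) -/N normE; ring.
Qed.

End InnerProduct.

(** * The kernel of the adjoint *)

Section SymmetricElliptic.
Variables (K : numFieldType) (theta : K -> K) (hK : RorC theta).
Variables (X Y H : completeNormedModType K) (ip : {dot H for theta}).
Hypothesis hH : forall u : H, `|u| ^+ 2 = ip u u.
Variables (i : {linear X -> Y}) (j : {linear Y -> H}).
Hypotheses (i_dense : dense (range i)).
Hypotheses (j_cont : continuous j) (j_inj : injective j).

(** The inclusion of [Y] into [Y^*] through [H = H^*]; it is conjugate-linear in
    [y]. *)
Definition embed_dual (y : Y) : Y -> K^o := adjoint j (riesz ip (j y)).

Lemma embed_dual_linear y : linear (embed_dual y).
Proof.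
by move=> a u w; rewrite /embed_dual /adjoint /riesz /= !linearP linearPl.
Qed.

HB.instance Definition _ y :=
  GRing.isLinear.Build K Y K^o _ (embed_dual y) (embed_dual_linear y).

Lemma embed_dual_continuous y : continuous (embed_dual y).
Proof.
apply: bounded_linear_continuous; apply/linear_boundedP.
have /linear_bounded_continuous/linear_boundedP/pinfty_ex_gt0[r r0 jr] := j_cont.
exists (`|j y| * r); split=> [|q qr u].
  by rewrite ger0_real // mulr_ge0 // ltW.
apply: (le_trans (cauchy_schwarz hK hH (j u) (j y))).
apply: (@le_trans _ _ (`|j y| * r * `|u|)); last by rewrite ler_wpM2r // ltW.
by rewrite -mulrA ler_wpM2l.
Qed.

Lemma embed_dual_definite y : embed_dual y y = 0 -> y = 0.
Proof.
by move=> /(ip_definite hH) jy; apply: j_inj; rewrite jy linear0.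
Qed.

Lemma embed_dual_separated y : y != 0 ->
  exists2 psi : {linear Y -> K^o}, continuous psi & psi y != 0.
Proof.
move=> y0; exists (embed_dual y : {linear Y -> K^o}).
  exact: embed_dual_continuous.
by apply: contra_neq y0 => /embed_dual_definite.
Qed.

(** The functional of [y] is continuous and vanishes on the dense range of [i],
    hence at [y] itself. *)
Lemma embed_dual_dense y : (forall x, embed_dual y (i x) = 0) -> y = 0.
Proof.
move=> yi; apply: embed_dual_definite.
have cl : closed (embed_dual y @^-1` [set 0]).
  apply: preimage_closed => [u _|]; first exact: embed_dual_continuous.
  exact: accessible_closed_set1 (hausdorff_accessible (@norm_hausdorff K K^o)) 0.
apply: contrapT => yn.
have yn0 : ~` (embed_dual y @^-1` [set 0]) !=set0 by exists y.
have [u [nu [x _ xu]]] := i_dense yn0 (closed_openC cl).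
by apply: nu; rewrite -xu; apply: yi.
Qed.

Variable T : {linear X -> Y}.
Hypothesis T_sym :
  forall x1 x2 : X, ip (j (T x1)) (j (i x2)) = ip (j (i x1)) (j (T x2)).

(** Inside [Y^*], the intersection of [X] with [ker T^*] is [ker T]. *)
Lemma embed_dual_kerP x :
  ker T x <-> forall y, range T y -> embed_dual (i x) y = 0.
Proof.
rewrite /ker /=; split=> [Tx y [x' _ <-]|ann].
  by rewrite /embed_dual /adjoint /riesz /= T_sym Tx linear0 linear0r.
apply: embed_dual_dense => x'.
by rewrite /embed_dual /adjoint /riesz /= -T_sym; apply: ann; exists x'.
Qed.

Hypothesis i_inj : injective i.
Hypothesis T_elliptic : forall phi : Y -> K^o, dual phi ->
  (exists y : Y, adjoint T phi = adjoint i (adjoint j (riesz ip (j y)))) ->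
  exists x : X, phi = embed_dual (i x).

(** The coordinates [c k] of [Y / range T] form a basis of [ker T^*].  By
    ellipticity [c k] is the image of some [w k] in [ker T], and the [w k] form
    a basis of [ker T]: evaluating a relation between them at the vectors [v l]
    shows independence, and the coefficients of [x] are the conjugates of the
    values of its functional at the [v k]. *)
Lemma ker_dim m : closed (range T) ->
  quotient_dim_eq [set: Y] (range T) m -> quotient_dim_eq (ker T) [set 0] m.
Proof.
move=> clT [v vbasis].
have [thetaK normE] := RorC_conjugation hK.
have theta_eq0 a : theta a = 0 -> a = 0.
  move=> ta; apply/eqP; have /eqP := normE a.
  by rewrite ta mulr0 sqrf_eq0 normr_eq0.
have subT := subspace_range T.
have [c [cP cT cv]] := quotient_coords subT vbasis.
have ccont := continuous_coords embed_dual_separated clT cP cT cv.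
have /choice[w wE] : forall k, exists x, (c k : Y -> K^o) = embed_dual (i x).
  move=> k; apply: T_elliptic; first by split; [exact: linearP|exact: ccont].
  exists 0; apply/funext => x; rewrite /adjoint /riesz /= cT; last by exists x.
  by rewrite linear0 linear0r.
have dualE (a : 'I_m -> K) y :
    embed_dual (i (\sum_k a k *: w k)) y = \sum_k theta (a k) * c k y.
  rewrite /embed_dual /adjoint /riesz /= !linear_sum.
  by apply: eq_bigr => k _; rewrite !linearZ wE.
exists w; split=> [k|a|x /embed_dual_kerP ann].
- by apply/embed_dual_kerP => y Ty; rewrite -wE cT.
- move=> /= a0 l; apply: theta_eq0; have := dualE a (v l).
  rewrite a0 /embed_dual /adjoint /riesz /= !linear0.
  rewrite (bigD1 l) //= cv eqxx mulr1 big1 ?addr0 // => k kl.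
  by rewrite cv (negPf kl) mulr0.
- exists (fun k => theta (embed_dual (i x) (v k))).
  set s := \sum_(k < m) _; apply/subr0_eq; rewrite subr0.
  apply: i_inj; rewrite linear0; apply: embed_dual_definite.
  suff dE : embed_dual (i (x - s)) =1 \0 by rewrite dE.
  move=> y; rewrite [LHS](_ : _ = embed_dual (i x) y - embed_dual (i s) y); last first.
    by rewrite /embed_dual /adjoint /riesz /= !linearB.
  rewrite dualE; have := ann _ (cP y); rewrite linearB linear_sum.
  move=> /eqP; rewrite subr_eq0 => /eqP ->; apply/eqP; rewrite subr_eq0.
  apply/eqP/eq_bigr => k _; rewrite thetaK linearZ; exact: mulrC.
Qed.

End SymmetricElliptic.

Theorem mainTheorem6
  (K : numFieldType) (theta : K -> K) (hK : RorC theta)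
  (X Y H : completeNormedModType K)
  (ip : {dot H for theta}) (hH : forall u : H, `|u| ^+ 2 = ip u u)
  (i : {linear X -> Y}) (j : {linear Y -> H})
  (i_cont : continuous i) (i_inj : injective i) (i_dense : dense (range i))
  (j_cont : continuous j) (j_inj : injective j) (j_dense : dense (range j))
  (T : {linear X -> Y}) (T_fredholm : fredholm T)
  (T_sym : forall x1 x2 : X, ip (j (T x1)) (j (i x2)) = ip (j (i x1)) (j (T x2)))
  (T_elliptic : forall phi : Y -> K^o, dual phi ->
     (exists y : Y, adjoint T phi = adjoint i (adjoint j (riesz ip (j y)))) ->
     exists x : X, phi = adjoint j (riesz ip (j (i x)))) :
  fredholm_index T = 0.
Proof.
have [_ _ clT [m coker_m]] := T_fredholm.
have ker_m := ker_dim hK hH i_dense j_cont j_inj T_sym i_inj T_elliptic clT coker_m.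
rewrite /fredholm_index (quotient_dimE (subspace0 X) ker_m).
by rewrite (quotient_dimE (subspace_range T) coker_m) subrr.
Qed.
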